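(* Let $q$ and $q'$ be prime powers with $q = (q')^k$ for a positive integer $k$, and let $t$ be a positive integer with $t < q'$. Let $V = \mathbb{F}_q \times \mathbb{F}_{q^2} \times \cdots \times \mathbb{F}_{q^t}$, let $$P_{t,q}(v) = N_t(v_t) + N_{t-1}(v_{t-1}) + \cdots + N_2(v_2) + v_1 \quad (v=(v_1,\dots,v_t)\in V),$$ and for $u \in \mathbb{F}_q$ let $S_u = \{v \in V : P_{t,q}(v) = u\}$. Then, viewing $V$ as the affine space $\mathrm{AG}\left(k\binom{t+1}{2}, q'\right)$ over $\mathbb{F}_{q'}$, the set $S_u$ is a maximal $t$-line evasive set in $\mathrm{AG}\left(k\binom{t+1}{2}, q'\right)$.
   Context: $\mathbb{F}_{q^i}$ is the finite field with $q^i$ elements. For $i \ge 1$, $N_i : \mathbb{F}_{q^i} \to \mathbb{F}_q$ is the field norm $N_i(y) = y^{1+q+\cdots+q^{i-1}}$. $V$ is a vector space over $\mathbb{F}_q$ of dimension $\binom{t+1}{2}$, hence over the subfield $\mathbb{F}_{q'}$ of dimension $k\binom{t+1}{2}$. An affine line over $\mathbb{F}_{q'}$ in $V$ is a set $\{ax+b : x \in \mathbb{F}_{q'}\}$ with $a,b\in V$, $a\neq 0$. A set $K \subseteq V$ is $t$-line evasive (over $\mathbb{F}_{q'}$) if every affine line over $\mathbb{F}_{q'}$ meets $K$ in at most $t$ points; it is maximal if no set strictly containing it is $t$-line evasive. *)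

(* Defs.v *)
From HB Require Import structures.
From mathcomp Require Import all_boot all_order all_fingroup all_algebra all_field.

Set Implicit Arguments.
Unset Strict Implicit.
Unset Printing Implicit Defensive.

Import GRing.Theory.
Local Open Scope ring_scope.

Section LineEvasive.

Variables (K : finFieldType) (V : finLmodType K).

Definition affine_line (a b : V) : {set V} := [set x *: a + b | x : K].

Definition line_evasive (t : nat) (S : {set V}) : Prop :=
  forall a b : V, a != 0 -> (#|S :&: affine_line a b| <= t)%N.

Definition maximal_line_evasive (t : nat) (S : {set V}) : Prop :=
  line_evasive t S /\ forall S' : {set V}, S \proper S' -> ~ line_evasive t S'.

End LineEvasive.

(* The finite field L viewed as a vector space over K through the field       *)
(* embedding f : K -> L, that is, x *: y = f x * y.                           *)
Section RestrictScalars.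

Variables (K L : finFieldType) (f : {rmorphism K -> L}).

Definition over_sub (g : {rmorphism K -> L}) : Type := L.
Local Notation W := (over_sub f).

HB.instance Definition _ := Finite.on W.
HB.instance Definition _ := GRing.Zmodule.on W.

Definition over_sub_scale (x : K) (y : W) : W := (f x * (y : L) : L).

Fact over_sub_scaleA a b v :
  over_sub_scale a (over_sub_scale b v) = over_sub_scale (a * b) v.
Proof. by rewrite /over_sub_scale rmorphM mulrA. Qed.

Fact over_sub_scale1 : left_id 1 over_sub_scale.
Proof. by move=> v; rewrite /over_sub_scale rmorph1 mul1r. Qed.

Fact over_sub_scaleDr : right_distributive over_sub_scale +%R.
Proof. by move=> a u v; rewrite /over_sub_scale; exact: mulrDr. Qed.

Fact over_sub_scaleDl v : {morph over_sub_scale^~ v : a b / a + b}.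
Proof. by move=> a b; rewrite /over_sub_scale rmorphD; exact: mulrDl. Qed.

HB.instance Definition _ := GRing.Zmodule_isLmodule.Build K W
  over_sub_scaleA over_sub_scale1 over_sub_scaleDr over_sub_scaleDl.

End RestrictScalars.

Section Product.

Variables (K : finFieldType) (I : finType) (W : I -> finLmodType K).

Definition prod_space : Type := {dffun forall i : I, W i}.

HB.instance Definition _ := Finite.on prod_space.

Implicit Types v w : prod_space.

Definition prod_add v w : prod_space := [ffun i => v i + w i].
Definition prod_opp v : prod_space := [ffun i => - v i].
Definition prod_zero : prod_space := [ffun i => 0].
Definition prod_scale (x : K) v : prod_space := [ffun i => x *: v i].

Fact prod_addA : associative prod_add.
Proof. by move=> u v w; apply/ffunP=> i; rewrite !ffunE addrA. Qed.
Fact prod_addC : commutative prod_add.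
Proof. by move=> u v; apply/ffunP=> i; rewrite !ffunE addrC. Qed.
Fact prod_add0 : left_id prod_zero prod_add.
Proof. by move=> v; apply/ffunP=> i; rewrite !ffunE add0r. Qed.
Fact prod_addN : left_inverse prod_zero prod_opp prod_add.
Proof. by move=> v; apply/ffunP=> i; rewrite !ffunE addNr. Qed.

HB.instance Definition _ :=
  GRing.isZmodule.Build prod_space prod_addA prod_addC prod_add0 prod_addN.

Fact prod_scaleA a b v : prod_scale a (prod_scale b v) = prod_scale (a * b) v.
Proof. by apply/ffunP=> i; rewrite !ffunE scalerA. Qed.
Fact prod_scale1 : left_id 1 prod_scale.
Proof. by move=> v; apply/ffunP=> i; rewrite !ffunE scale1r. Qed.
Fact prod_scaleDr : right_distributive prod_scale +%R.
Proof. by move=> a u v; apply/ffunP=> i; rewrite !ffunE scalerDr. Qed.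
Fact prod_scaleDl v : {morph prod_scale^~ v : a b / a + b}.
Proof. by move=> a b; apply/ffunP=> i; rewrite !ffunE scalerDl. Qed.

HB.instance Definition _ := GRing.Zmodule_isLmodule.Build K prod_space
  prod_scaleA prod_scale1 prod_scaleDr prod_scaleDl.

End Product.

(* With q = #|F| and #|L| = q ^ n, y ^ (1 + q + ... + q ^ (n - 1)) lies in    *)
(* the image of the embedding e : F -> L, and ff_norm e n y is its preimage:  *)
(* see ff_normE.                                                              *)
Definition ff_norm (F L : finFieldType) (e : {rmorphism F -> L}) (n : nat)
    (y : L) : F :=
  odflt 0 [pick z : F | e z == y ^+ (\sum_(j < n) #|F| ^ j)%N].

Lemma ff_normE (F L : finFieldType) (e : {rmorphism F -> L}) (n : nat) (y : L) :
  #|L| = (#|F| ^ n)%N ->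
  e (ff_norm e n y) = y ^+ (\sum_(j < n) #|F| ^ j)%N.
Proof.
move=> cardL; rewrite /ff_norm; case: pickP => [z /eqP //|no_z] /=.
set s := (\sum_(j < n) _)%N in no_z *; exfalso.
have fixed : (y ^+ s) ^+ #|F| = y ^+ s.
  have sE : (s * #|F| + 1 = s + #|F| ^ n)%N.
    rewrite big_distrl /= /s -(big_mkord xpredT (fun j => #|F| ^ j)%N).
    rewrite -(big_mkord xpredT (fun j => #|F| ^ j * #|F|)%N).
    under eq_bigr do rewrite -expnSr.
    by rewrite -big_nat_recr //= big_nat_recl //= addnC expn0.
  have [y0|y_neq0] := eqVneq y 0.
    rewrite y0; case: (s) => [|s']; first by rewrite expr0 expr1n.
    by rewrite exprS mul0r expr0n -[#|F|]prednK ?(ltnW (finNzRing_gt1 F)).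
  apply: (mulIf y_neq0).
  by rewrite -exprM -exprSr -addn1 sE exprD -cardL expf_card.
have: (map_poly e ('X^#|F| - 'X)).[y ^+ s] == 0.
  by rewrite rmorphB /= map_polyXn map_polyX !hornerE fixed subrr.
rewrite finField_genPoly rmorph_prod horner_prod prodf_seq_eq0 => /hasP[z _ /=].
rewrite rmorphB /= map_polyX map_polyC !hornerE subr_eq0 => /eqP yE.
by have := no_z z; rewrite yE eqxx.
Qed.

Section Hypersurface.

(* K = F_q', F = F_q and L i = F_(q ^ (i + 2)) for 0 <= i < t - 1: the first     *)
(* factor of the space is F itself, so only the t - 1 other ones are indexed. *)
(* The inclusions of F_q' in F_q and of F_q in F_(q ^ (i + 2)) are the       *)
(* embeddings iota and e i.                                                   *)
Variables (K F : finFieldType) (iota : {rmorphism K -> F}).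
Variables (t : nat) (L : 'I_t.-1 -> finFieldType).
Variable e : forall i, {rmorphism F -> L i}.

(* F_q x F_(q ^ 2) x ... x F_(q ^ t), as a vector space over K.               *)
Definition Vspace : Type :=
  (over_sub iota * prod_space (fun i => over_sub (e i \o iota)))%type.

HB.instance Definition _ := Finite.on Vspace.
HB.instance Definition _ := GRing.Lmodule.on Vspace.

Definition P_tq (v : Vspace) : F :=
  (v.1 : F) + \sum_(i < t.-1) ff_norm (e i) i.+2 (v.2 i).

Definition S_u (u : F) : {set Vspace} := [set v | P_tq v == u].

Lemma card_Vspace (k : nat) :
  (0 < t)%N -> #|F| = (#|K| ^ k)%N -> (forall i, #|L i| = #|F| ^ i.+2)%N ->
  #|{: Vspace}| = (#|K| ^ (k * 'C(t.+1, 2)))%N.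
Proof.
move=> t_gt0 cardF cardL.
have cardT : #|{: Vspace}| = (#|F| * \prod_(i < t.-1) #|L i|)%N.
  by rewrite card_prod card_dep_ffun foldrE big_image.
rewrite cardT; under eq_bigr do rewrite cardL.
rewrite -expn_sum -expnS cardF -expnM -bin2_sum; congr (_ ^ (_ * _))%N.
rewrite big_nat_recl // add0n -(big_mkord xpredT (fun i => i.+2)).
by rewrite -[in RHS](prednK t_gt0) big_nat_recl // add1n.
Qed.

End Hypersurface.

(* Main.v *)
(* Along a line [x |-> x a + b] with [x] in the small field, the norm
   [N_i (x a_i + b_i)] is a polynomial in [x] over [F_q] of degree at most [i],
   whose coefficient of degree [i] is [N_i a_i]. If [a != 0], the largest [i]
   with [a_i != 0] shows that [P (x a + b) - u] is a nonzero polynomial of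
   degree at most [t], so it has at most [t] roots. Conversely, norms of finite
   fields are surjective, so solving for [a_t], then [a_(t-1)], down to [a_1],
   every polynomial of degree at most [t] with constant term [P b] arises along
   some line through [b]. If [P b != u], take one assuming the value [u] at [t]
   distinct nonzero points: [b] and these [t] points of [S_u] are collinear. *)
Require Import Defs.
From HB Require Import structures.
From mathcomp Require Import all_boot all_order all_fingroup all_algebra all_field.
From mathcomp Require Import all_solvable.

Set Implicit Arguments.
Unset Strict Implicit.
Unset Printing Implicit Defensive.

Import GRing.Theory.
Local Open Scope ring_scope.

(** * Frobenius map and norm of an extension of finite fields *)

Lemma card_finField_pchar_nat (F : finFieldType) : [pchar F].-nat #|F|.
Proof.
have [p _ pcharFp] := finPcharP F.
rewrite (eq_pnat _ (pcharf_eq pcharFp)) -cardsT.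
exact: abelem_pgroup (fin_ring_pchar_abelem pcharFp).
Qed.

Section NormPolynomial.

Variables (F L : finFieldType) (e : {rmorphism F -> L}).

(** The embedding [e] gives [L] the characteristic of [F], and [#|F|] is a power of it. *)
Lemma exprD_card (x y : L) : (x + y) ^+ #|F| = x ^+ #|F| + y ^+ #|F|.
Proof.
apply: exprDn_pchar.
apply: sub_in_pnat (card_finField_pchar_nat F) => p _.
exact: rmorph_pchar.
Qed.

(** Bundling the Frobenius map as a ring morphism lets it act on polynomials coefficientwise. *)
Lemma expr_card_rmorphism :
  exists Frob : {rmorphism L -> L}, forall y, Frob y = y ^+ #|F|.
Proof.
have exprB : {morph (fun y : L => y ^+ #|F|) : x y / x - y}.
  by move=> x y; apply: (addIr (y ^+ #|F|)); rewrite -exprD_card !subrK.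
have exprM : monoid_morphism (fun y : L => y ^+ #|F|).
  by split=> [|x y]; rewrite ?expr1n ?exprMn.
pose Frob_add := GRing.isZmodMorphism.Build L L _ exprB.
pose Frob_mul := GRing.isMonoidMorphism.Build L L _ exprM.
pose Frob : {rmorphism L -> L} :=
  HB.pack (fun y : L => y ^+ #|F|) Frob_add Frob_mul.
by exists Frob.
Qed.

(** Over [F], ['X^#|F| - 'X] is the product of all ['X - z], so the roots in [L] of its image are
    the [e z]. *)
Lemma fixed_expr_card (y : L) : y ^+ #|F| = y -> exists x, e x = y.
Proof.
move=> fixed.
have: (map_poly e ('X^#|F| - 'X)).[y] == 0.
  by rewrite rmorphB /= map_polyXn map_polyX !hornerE fixed subrr.
rewrite finField_genPoly rmorph_prod horner_prod prodf_seq_eq0 => /hasP[z _ /=].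
rewrite rmorphB /= map_polyX map_polyC !hornerE subr_eq0 => /eqP yE.
by exists z.
Qed.

Lemma expf_card_exp (x : F) j : x ^+ (#|F| ^ j) = x.
Proof. by elim: j => [|j IHj]; rewrite ?expr1 // expnSr exprM IHj expf_card. Qed.

(** Some [c j] may vanish, hence a bound on the size and the coefficient of index [n] rather than a
    leading coefficient. *)
Lemma size_coef_prod_linear (R : nzRingType) (c d : nat -> R) n :
  (size (\prod_(j < n) ((c j)%:P * 'X + (d j)%:P))%R <= n.+1)%N /\
  (\prod_(j < n) ((c j)%:P * 'X + (d j)%:P))`_n = \prod_(j < n) c j.
Proof.
elim: n => [|n [size_n coef_n]]; first by rewrite !big_ord0 size_poly1 coefC.
rewrite !big_ord_recr /=; set p := \prod_(j < n) _ in size_n coef_n *.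
have size_lin : (size ((c n)%:P * 'X + (d n)%:P)%R <= 2)%N.
  by rewrite size_MXaddC; case: ifP => // _; rewrite ltnS size_polyC leq_b1.
split.
  apply: leq_trans (size_polyMleq _ _) _.
  by rewrite -subn1 leq_subLR (leq_trans (leq_add size_n size_lin)) // addn2.
rewrite mulrDr mulrA coefD coefMX coefMC /= coefMC coef_n.
by rewrite [p`_n.+1]nth_default // mul0r addr0.
Qed.

Variable n : nat.
Hypotheses (n_gt0 : (0 < n)%N) (cardL : #|L| = (#|F| ^ n)%N).

Lemma ff_norm0 : ff_norm e n 0 = 0.
Proof.
apply/eqP; rewrite -(fmorph_eq0 e) ff_normE // expf_eq0 eqxx andbT.
(* The exponent is positive because it contains the term [#|F| ^ 0]. *)
by case: n n_gt0 => // m _; rewrite big_ord_recl expn0.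
Qed.

Lemma ff_norm_eq0 y : (ff_norm e n y == 0) = (y == 0).
Proof.
apply/idP/eqP => [|->]; last by rewrite ff_norm0.
by rewrite -(fmorph_eq0 e) ff_normE // expf_eq0 => /andP[_ /eqP].
Qed.

(** The unit group of [L] is cyclic of order $(q-1)s$, where $q$ is the order of [F] and $s$ the
    norm exponent. If [g] generates it and $e(z) = g^m$, then $z^{q-1} = 1$ forces $s \mid m$, and
    $g^{m/s}$ has norm [z]. *)
Lemma ff_norm_surj z : exists y, ff_norm e n y = z.
Proof.
have [->|z_neq0] := eqVneq z 0; first by exists 0; exact: ff_norm0.
have ez_neq0 : e z != 0 by rewrite fmorph_eq0.
have /cyclicP[g gE] := field_unit_group_cyclic [set: {unit L}]%G.
set s := (\sum_(j < n) #|F| ^ j)%N.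
have orderg : #[g]%g = (#|F|.-1 * s)%N.
  by rewrite orderE -gE card_finField_unit cardL predn_exp.
have /cycleP[m ezE] : finField_unit ez_neq0 \in <[g]>%g by rewrite -gE inE.
have {}ezE : e z = val g ^+ m by rewrite -FinRing.val_unitX -ezE.
have q_gt1 := finNzRing_gt1 F.
have dvd_s : (s %| m)%N.
  have : (g ^+ (m * #|F|.-1) == 1)%g.
    rewrite -val_eqE /= FinRing.val_unitX exprM -ezE -rmorphXn.
    suff -> : z ^+ #|F|.-1 = 1 by rewrite rmorph1.
    apply: (mulfI z_neq0).
    by rewrite -exprS prednK ?expf_card ?mulr1 // ltnW.
  rewrite -order_dvdn orderg mulnC dvdn_pmul2r //.
  by rewrite -ltnS prednK // ltnW.
exists (val g ^+ (m %/ s)); apply: (fmorph_inj e).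
by rewrite ff_normE // -/s -exprM divnK.
Qed.

(* The polynomial is [\prod_(j < n) (a ^+ (q ^ j) X + b ^+ (q ^ j))], whose
   coefficients are fixed by the Frobenius map [y |-> y ^+ q]; it agrees with
   the norm on [F] because [x ^+ q = x] there. *)
Lemma ff_norm_line_poly (a b : L) :
  exists p : {poly F},
    [/\ (size p <= n.+1)%N, p`_n = ff_norm e n a, a = 0 -> (size p <= 1)%N
      & forall x, p.[x] = ff_norm e n (e x * a + b)].
Proof.
pose lin j := (a ^+ (#|F| ^ j))%:P * 'X + (b ^+ (#|F| ^ j))%:P : {poly L}.
pose P := \prod_(j < n) lin j.
have [sizeP coefP] : (size P <= n.+1)%N /\ P`_n = e (ff_norm e n a).
  rewrite ff_normE // expr_sum.
  exact: (size_coef_prod_linear (fun j => a ^+ (#|F| ^ j)%N)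
                                (fun j => b ^+ (#|F| ^ j)%N)).
have fixedP i : P`_i ^+ #|F| = P`_i.
  have [Frob FrobE] := expr_card_rmorphism.
  have Frob_lin j : map_poly Frob (lin j) = lin j.+1.
    rewrite rmorphD rmorphM /= !map_polyC map_polyX /= !FrobE.
    by rewrite -!exprM -!expnSr.
  rewrite -FrobE -coef_map; congr (_`_i).
  rewrite rmorph_prod /=; under eq_bigr => j _ do rewrite Frob_lin.
  (* Frobenius permutes the factors cyclically: [lin n] is [lin 0], since $y^{q^n} = y$ on [L]. *)
  rewrite /P -(big_mkord xpredT lin) -(big_mkord xpredT (lin \o succn)).
  rewrite -[n in LHS](prednK n_gt0) -[n in RHS](prednK n_gt0).
  rewrite big_nat_recr // big_nat_recl //= mulrC.
  by rewrite prednK // /lin -cardL !expf_card expn0 !expr1.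
have [p pE] : exists p : {poly F}, map_poly e p = P.
  have /fin_all_exists[c cE] : forall i : 'I_(size P), exists x, e x = P`_i.
    by move=> i; apply: fixed_expr_card.
  exists (\poly_(i < size P) (oapp c 0 (insub i))).
  apply/polyP=> i; rewrite coef_map coef_poly; case: ltnP => [lt_i|le_i].
    by rewrite insubT /= cE.
  by rewrite raddf0 nth_default.
exists p; split.
- by rewrite -(size_map_poly e) pE.
- by apply: (fmorph_inj e); rewrite -coef_map pE.
- move=> a0; rewrite -(size_map_poly e) pE.
  have -> : P = (\prod_(j < n) b ^+ (#|F| ^ j))%:P.
    rewrite rmorph_prod; apply: eq_bigr => j _.
    rewrite /lin a0 expr0n expn_eq0 -leqn0 leqNgt (ltnW (finNzRing_gt1 F)) /=.
    by rewrite mul0r add0r.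
  by rewrite size_polyC leq_b1.
- move=> x; apply: (fmorph_inj e); rewrite -horner_map pE ff_normE // expr_sum.
  rewrite horner_prod; apply: eq_bigr => j _.
  rewrite /lin !hornerE -[in LHS](expf_card_exp x j) rmorphXn -exprMn mulrC.
  elim: (nat_of_ord j) => [|i IHi]; first by rewrite !expr1.
  by rewrite expnSr !exprM -exprD_card -IHi.
Qed.

End NormPolynomial.

(* Downward elimination: [p i] is chosen to cancel the coefficient of degree
   [i + 2] left over by the polynomials of higher index. *)
Lemma eliminate_high_coefs (R : nzRingType) (A : nat -> {poly R} -> Prop) m :
  (forall i, (i < m)%N -> forall z,
     exists2 p, A i p & (size p <= i.+3)%N /\ p`_i.+2 = z) ->
  forall c : {poly R}, (size c <= m.+2)%N ->
  exists2 p : nat -> {poly R}, forall i, (i < m)%N -> A i (p i) &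
    (size (c - \sum_(i < m) p i)%R <= 2)%N.
Proof.
elim: m => [_ c size_c|m IHm surjA c size_c].
  by exists (fun=> 0) => //; rewrite big_ord0 subr0.
have [pm Apm [size_pm coef_pm]] := surjA m (ltnSn m) c`_m.+2.
have size_rest : (size (c - pm)%R <= m.+2)%N.
  apply/leq_sizeP=> j; rewrite leq_eqVlt => /orP[/eqP <-|lt_mj].
    by rewrite coefB coef_pm subrr.
  by rewrite coefB !nth_default ?subr0 // (leq_trans _ lt_mj).
have [|p Ap size_p] := IHm _ _ size_rest.
  by move=> i lt_im; apply: surjA; apply: ltnW.
exists (fun i => if i == m then pm else p i) => [i|].
  rewrite ltnS leq_eqVlt; case: eqVneq => [->|_] //=; exact: Ap.
rewrite big_ord_recr /= eqxx addrC opprD addrA -addrA addrA.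
under eq_bigr => i _ do rewrite ltn_eqF //.
by rewrite addrAC addrC addrA in size_p *.
Qed.

(** * Restriction of [P_tq] to the lines of the space *)

Section Lines.

Variables (K F : finFieldType) (iota : {rmorphism K -> F}).
Variables (t : nat) (L : 'I_t.-1 -> finFieldType).
Variable e : forall i, {rmorphism F -> L i}.
Hypothesis cardL : forall i, #|L i| = (#|F| ^ i.+2)%N.
Hypothesis t_gt0 : (0 < t)%N.

Local Notation V := (Vspace iota e).

Lemma P_tq_line (a b : V) x :
  P_tq (x *: a + b) = iota x * (a.1 : F) + (b.1 : F)
    + \sum_i ff_norm (e i) i.+2 (e i (iota x) * (a.2 i : L i) + (b.2 i : L i)).
Proof. by congr (_ + _); apply: eq_bigr => i _; rewrite !ffunE. Qed.

Lemma P_tq_line_poly (a b : V) (u : F) : a != 0 ->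
  exists Q : {poly F}, [/\ Q != 0, (size Q <= t.+1)%N &
    forall x, Q.[iota x] = P_tq (x *: a + b) - u].
Proof.
move=> a_neq0.
have /fin_all_exists[N NP] (i : 'I_t.-1) :=
  ff_norm_line_poly (e i) (ltn0Sn i.+1) (cardL i) (a.2 i) (b.2 i).
pose l := (a.1 : F)%:P * 'X + (b.1 - u : F)%:P.
have size_l : (size l <= 2)%N.
  by rewrite size_MXaddC; case: ifP => // _; rewrite ltnS size_polyC leq_b1.
exists (l + \sum_i N i); split.
- apply: contra_neq a_neq0 => Q0.
  have a2_0 : forall i, a.2 i = 0.
    move=> i; apply/eqP; apply: contraT => ai_neq0.
    (* For the largest such [j], only [N j] contributes in degree [j.+2]: lower indices give smaller
       degrees, higher ones give constants. *)
    have [j aj_neq0 j_max] := @arg_maxnP _ i (fun i => a.2 i != 0) val ai_neq0.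
    have [size_j coef_j _ _] := NP j.
    have : (l + \sum_i N i)`_j.+2 = 0 by rewrite Q0 coef0.
    rewrite coefD nth_default ?(leq_trans size_l) // add0r coef_sum (bigD1 j) //=.
    rewrite big1 ?addr0 ?coef_j => [/eqP|k k_neq_j].
      by rewrite ff_norm_eq0 // (negPf aj_neq0).
    have [size_k _ const_k _] := NP k.
    apply: nth_default; have [ak0|/j_max le_kj] := eqVneq (a.2 k) 0.
      exact: leq_trans (const_k ak0) _.
    by rewrite (leq_trans size_k) // !ltnS ltn_neqAle k_neq_j.
  (* All the [N i] are now constant, so the coefficient of degree 1 is [a.1]. *)
  have a1_0 : a.1 = 0.
    have := congr1 (fun p : {poly F} => p`_1) Q0.
    rewrite coef0 coefD coef_sum big1 ?addr0 => [|i _].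
      by rewrite coefD coefMX coefC coefC /= addr0.
    have [_ _ const_i _] := NP i.
    exact: nth_default (const_i (a2_0 i)).
  have a2E : a.2 = 0 by apply/ffunP=> i; rewrite a2_0 ffunE.
  by rewrite [LHS]surjective_pairing a1_0 a2E.
- apply: leq_trans (size_polyD _ _) _; rewrite geq_max (leq_trans size_l) //=.
  apply: leq_trans (size_sum _ _ _) _; apply/bigmax_leqP => i _.
  have [size_i _ _ _] := NP i; apply: leq_trans size_i _.
  by rewrite ltnS -[t in (_ <= t)%N]prednK // ltnS.
- move=> x; rewrite P_tq_line hornerD horner_sum !hornerE.
  under eq_bigr => i _ do rewrite (let: And4 _ _ _ NE := NP i in NE).
  by rewrite addrAC /= [_ * iota x]mulrC.
Qed.

Lemma P_tq_line_surj (b : V) (c : {poly F}) :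
  (size c <= t.+1)%N -> c.[0] = P_tq b ->
  exists a : V, forall x, P_tq (x *: a + b) = c.[iota x].
Proof.
move=> size_c c0.
(* The elimination is indexed by [nat] and [L] by ordinals; the equation between [j] and [i] bridges
   the two. *)
pose A i (p : {poly F}) := forall j : 'I_t.-1, j = i :> nat ->
  exists a : L j, forall x, p.[x] = ff_norm (e j) j.+2 (e j x * a + (b.2 j : L j)).
have surjA i : (i < t.-1)%N -> forall z,
    exists2 p, A i p & (size p <= i.+3)%N /\ p`_i.+2 = z.
  move=> lt_it z; pose j := Ordinal lt_it.
  have [a aE] := ff_norm_surj (e j) (ltn0Sn i.+1) (cardL j) z.
  have [p [size_p coef_p _ pE]] :=
    ff_norm_line_poly (e j) (ltn0Sn i.+1) (cardL j) a (b.2 j).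
  exists p; last by rewrite coef_p aE.
  by move=> j' /(@ord_inj _ j' j) ->; exists a.
have [|p Ap] := eliminate_high_coefs surjA (c := c).
  by rewrite -addn1 prednK // addn1.
set d := c - _ => size_d.
have /fin_all_exists[a aE] (i : 'I_t.-1) := Ap i (ltn_ord i) i erefl.
have dE x : d.[x] = x * d`_1 + d`_0.
  rewrite (horner_coef_wide _ size_d) !big_ord_recl big_ord0 /=.
  by rewrite expr0 mulr1 addr0 addrC mulrC expr1.
(* The remainder [d] has degree at most 1, and the first component of the direction supplies its
   slope. *)
pose v : V := (d`_1 : over_sub iota, [ffun i => a i : over_sub (e i \o iota)]).
have vE x : P_tq (x *: v + b) = c.[iota x] + (b.1 : F) - d`_0.
  rewrite P_tq_line /=.
  under eq_bigr => i _ do rewrite ffunE -aE.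
  have -> : c = d + \sum_(i < t.-1) p i by rewrite subrK.
  rewrite hornerD horner_sum dE.
  by rewrite [RHS]addrAC [in RHS](addrAC (_ * _)) addrK addrAC.
exists v => x; rewrite vE -addrA.
(* At [x = 0] both sides are [P_tq b], so the leftover constant vanishes. *)
have := vE 0; rewrite scale0r add0r rmorph0 c0 -addrA => b_d0.
have -> : (b.1 : F) - d`_0 = 0 by apply: (addrI (P_tq b)); rewrite -b_d0 addr0.
exact: addr0.
Qed.

End Lines.

Theorem theorem3p2 (q q' k t : nat) (K F : finFieldType)
    (L : 'I_t.-1 -> finFieldType)
    (iota : {rmorphism K -> F}) (e : forall i, {rmorphism F -> L i})
    (k_gt0 : (0 < k)%N) (qE : q = (q' ^ k)%N)
    (t_gt0 : (0 < t)%N) (t_lt_q' : (t < q')%N)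
    (cardK : #|K| = q') (cardF : #|F| = q)
    (cardL : forall i, #|L i| = (q ^ i.+2)%N) (u : F) :
  maximal_line_evasive t (S_u iota e u).
Proof.
have {}cardL i : #|L i| = (#|F| ^ i.+2)%N by rewrite cardF.
split=> [a b a_neq0|S' /properP[sSS' [b bS' bS]] evasive].
  have [Q [Q_neq0 size_Q QE]] := P_tq_line_poly cardL t_gt0 b u a_neq0.
  pose Z := [set x : K | root Q (iota x)].
  have sub_Z :
      S_u iota e u :&: affine_line a b \subset [set x *: a + b | x in Z].
    apply/subsetP=> v /setIP[vS /imsetP[x _ vE]]; apply/imsetP; exists x => //.
    by move: vS; rewrite !inE rootE QE vE subr_eq0.
  apply: leq_trans (subset_leq_card sub_Z) _.
  apply: leq_trans (leq_imset_card _ _) _.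
  rewrite cardE -(size_map iota) -ltnS; apply: leq_trans size_Q.
  apply: max_poly_roots => //.
    by apply/allP=> _ /mapP[x + ->]; rewrite mem_enum inE.
  by rewrite (map_inj_uniq (fmorph_inj iota)) enum_uniq.
(* Maximality: [t < q'] leaves room for [t] distinct nonzero parameters. *)
have : (t <= #|[set~ 0%R : K]|)%N.
  by rewrite cardsC1 cardK -ltnS prednK // (leq_trans _ t_lt_q').
move=> /card_geqP[s [uniq_s size_s s_neq0]].
pose R := \prod_(y <- map iota s) ('X - y%:P).
have R0 : R.[0] != 0.
  rewrite -[_ == 0]/(root R 0) root_prod_XsubC.
  apply/mapP=> -[x /s_neq0]; rewrite !inE => x_neq0 /esym/eqP.
  by rewrite fmorph_eq0 (negPf x_neq0).
(* This interpolates [u] on [s], where [R] vanishes, and [P_tq b] at 0. *)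
pose c := u%:P + ((P_tq b - u) / R.[0])%:P * R.
have size_c : (size c <= t.+1)%N.
  apply: leq_trans (size_polyD _ _) _; rewrite geq_max size_polyC.
  rewrite (leq_trans (leq_b1 _)) //= mul_polyC (leq_trans (size_scale_leq _ _)) //.
  by rewrite size_prod_XsubC size_map size_s.
have c0 : c.[0] = P_tq b by rewrite !hornerE divfK // addrC subrK.
have [a aE] := P_tq_line_surj cardL t_gt0 size_c c0.
have on_S x : x \in s -> x *: a + b \in S_u iota e u.
  move=> xs; rewrite inE aE !hornerE.
  suff /eqP -> : R.[iota x] == 0 by rewrite mulr0 addr0.
  by rewrite -[_ == 0]/(root R _) root_prod_XsubC map_f.
(* As [t > 0], [s] has an element; with [a = 0] its point would be [b], which is outside [S_u]. *)
have a_neq0 : a != 0.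
  apply: contraNneq bS => a0; have x0s : s`_0 \in s by rewrite mem_nth ?size_s.
  by have := on_S _ x0s; rewrite a0 scaler0 add0r.
have := evasive a b a_neq0; rewrite leqNgt => /negP[].
pose f (x : K) : Vspace iota e := x *: a + b.
have f_inj : injective f.
  move=> x y /addIr/eqP; rewrite -subr_eq0 -scalerBl scaler_eq0.
  by rewrite (negPf a_neq0) orbF subr_eq0 => /eqP.
(* The parameter 0 gives [b] itself, the point number [t + 1] of [S'] on the line. *)
have uniq_0s : uniq (0 :: s).
  by rewrite /= uniq_s andbT; apply/negP => /s_neq0; rewrite !inE eqxx.
apply/card_geqP; exists (map f (0 :: s)).
split; [by rewrite (map_inj_uniq f_inj) | by rewrite size_map /= size_s | ].
move=> _ /mapP[x xs ->]; rewrite inE; apply/andP; split; last exact: imset_f.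
move: xs; rewrite inE => /predU1P[->|/on_S]; last exact: (subsetP sSS').
by rewrite /f scale0r add0r.
Qed.
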